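(* Let $(X,d)$ be a metric space and let $\psi=\{\psi_t\}_{t\in\mathbb{R}}$ be a continuous flow on $X$ such that $\psi_t$ is Lipschitz continuous for every $t\geq 0$, uniformly for $t$ in compact subsets of $[0,+\infty)$ (i.e. for every $T\ge 0$ there is a constant $C$ such that $d(\psi_t(x),\psi_t(y))\le C\,d(x,y)$ for all $x,y\in X$ and all $t\in[0,T]$). Then: (i) $\psi$ is strongly chain recurrent if and only if every Lipschitz continuous Lyapunov function $h:X\to\mathbb{R}$ for $\psi$ is a first integral of $\psi$. (ii) $\psi$ is strongly chain transitive if and only if every Lipschitz continuous Lyapunov function $h:X\to\mathbb{R}$ for $\psi$ is constant.
   Context: A continuous flow on $X$ is a continuous map $\psi:\mathbb{R}\times X\to X$, $\psi(t,x)=\psi_t(x)$, with $\psi_0=\mathrm{id}$ and $\psi_{t+s}=\psi_t\circ\psi_s$. Given $x,y\in X$, $\epsilon>0$, $T\ge 0$, a strong $(\epsilon,T)$-chain from $x$ to $y$ is a finite sequence $(x_i,t_i)_{i=1,\dots,n}\subset X\times\mathbb{R}$ ($n\ge 1$) with $t_i\ge T$ for all $i$, $x_1=x$ and, setting $x_{n+1}:=y$, $\sum_{i=1}^n d(\psi_{t_i}(x_i),x_{i+1})<\epsilon$. The flow $\psi$ is strongly chain recurrent if for every $x\in X$, every $\epsilon>0$ and every $T\ge0$ there is a strong $(\epsilon,T)$-chain from $x$ to $x$. It is strongly chain transitive if for every $x,y\in X$, every $\epsilon>0$ and every $T\ge 0$ there is a strong $(\epsilon,T)$-chain from $x$ to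 $y$. A function $h:X\to\mathbb{R}$ is a Lyapunov function for $\psi$ if $h\circ\psi_t\le h$ for every $t\ge0$, and a first integral if $h\circ\psi_t=h$ for every $t\in\mathbb{R}$. *)

(* Defs.v *)
From mathcomp Require Import all_boot all_order all_algebra.
From mathcomp Require Import all_classical all_reals topology normedtype.

Set Implicit Arguments.
Unset Strict Implicit.
Unset Printing Implicit Defensive.

Import Order.TTheory GRing.Theory Num.Theory.
Import numFieldNormedType.Exports.

Local Open Scope classical_set_scope.
Local Open Scope ring_scope.

Section StrongChains.
Context {R : realType} {X : metricType R}.
Implicit Types (psi : R -> X -> X) (h : X -> R).

Definition continuous_flow psi : Prop :=
  [/\ continuous (fun p : R * X => psi p.1 p.2),
      forall x, psi 0 x = x &
      forall t s x, psi (t + s) x = psi t (psi s x)].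

Definition lipschitz_on_compact_times psi : Prop :=
  forall T, 0 <= T -> exists C : R,
    forall x y t, 0 <= t <= T -> mdist (psi t x) (psi t y) <= C * mdist x y.

(* The library's [lipschitz] is restricted to maps between normed modules. *)
Definition lipschitz_fun h : Prop :=
  exists C : R, forall x y, `|h x - h y| <= C * mdist x y.

(* The chain (x_1, t_1), ..., (x_n, t_n) is the sequence [c], indexed from 0.
   The default value [y] of [nth] provides the convention x_{n+1} = y. *)
Definition strong_chain psi (eps T : R) (x y : X) (c : seq (X * R)) : Prop :=
  let p := nth y (unzip1 c) in
  let t := nth 0 (unzip2 c) in
  [/\ (0 < size c)%N,
      forall i, (i < size c)%N -> T <= t i,
      p 0%N = x &
      \sum_(i < size c) mdist (psi (t i) (p i)) (p i.+1) < eps].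

Definition strongly_chain_recurrent psi : Prop :=
  forall (x : X) (eps T : R), 0 < eps -> 0 <= T ->
    exists c, strong_chain psi eps T x x c.

Definition strongly_chain_transitive psi : Prop :=
  forall (x y : X) (eps T : R), 0 < eps -> 0 <= T ->
    exists c, strong_chain psi eps T x y c.

Definition lyapunov_function psi h : Prop :=
  forall t, 0 <= t -> forall x, h (psi t x) <= h x.

Definition first_integral psi h : Prop :=
  forall t x, h (psi t x) = h x.

End StrongChains.

(* Main.v *)
Require Import Defs.
From mathcomp Require Import all_boot all_order all_algebra.
From mathcomp Require Import all_classical all_reals topology normedtype.
From mathcomp Require Import ring lra.

(** A Lipschitz Lyapunov function decreases along a chain up to a multiple of
    the cost of the chain, which gives the "only if" parts.  Conversely, fix [x]
    and [T >= 0], and let [g y] be the infimum of the costs of the chains with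
    times at least [T] from [x] to a point [psi s y] with [0 <= s <= T].  The
    delay [s] makes [g] a Lyapunov function: a delay that becomes negative under
    [y |-> psi t y] is compensated by a further step of length at least [T].
    Since [g] vanishes at [psi T x], the assumption on Lyapunov functions yields
    [g (psi (- T) y) = 0], that is, arbitrarily cheap chains ending at
    [psi (s - T) y]; prolonging the last step by [T - s] makes them end at [y],
    at a cost multiplied by a Lipschitz constant. *)

Set Implicit Arguments.
Unset Strict Implicit.
Unset Printing Implicit Defensive.

Import Order.TTheory GRing.Theory Num.Theory.

Local Open Scope classical_set_scope.
Local Open Scope ring_scope.

Section StrongChainTheory.
Context {R : realType} {X : metricType R} (psi : R -> X -> X).
Implicit Types (e T t s r K C : R) (x y z a : X) (c : seq (X * R)) (h : X -> R).

(* Unlike [strong_chain], this allows the empty chain, from [x] to itself. *)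
Definition weak_chain e T x y c : Prop :=
  let p := nth y (unzip1 c) in
  let t := nth 0 (unzip2 c) in
  [/\ forall i, (i < size c)%N -> T <= t i,
      p 0%N = x &
      \sum_(i < size c) mdist (psi (t i) (p i)) (p i.+1) < e].

(** * Chains decomposed at their last step *)

Lemma strong_chainE e T x y c :
  strong_chain psi e T x y c <-> (0 < size c)%N /\ weak_chain e T x y c.
Proof. by split=> [[? ? ? ?]|[? [? ? ?]]]; split. Qed.

Lemma weak_chain_nil e T x y : weak_chain e T x y [::] <-> y = x /\ 0 < e.
Proof. by rewrite /weak_chain /= big_ord0; split=> [[]|[]]. Qed.

(** The endpoint enters only as the default value of [nth], so dropping the last pair [(a, t)] just
    turns this default from [y] into [a]; hence chains are analysed from the right. *)
Lemma weak_chain_rcons e T x y c a t :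
  weak_chain e T x y (rcons c (a, t)) <->
  T <= t /\ weak_chain (e - mdist (psi t a) y) T x a c.
Proof.
(* The case [i = size c] matters: [a] is the last entry on the left and the default value on the
   right. *)
have p_lt i : (i <= size c)%N ->
    nth y (unzip1 (rcons c (a, t))) i = nth a (unzip1 c) i.
  move=> ic; rewrite /unzip1 map_rcons nth_rcons size_map.
  case: ltngtP ic => //= [ic _|-> _].
    by apply: set_nth_default; rewrite size_map.
  by rewrite nth_default // size_map.
have t_lt i : (i < size c)%N ->
    nth 0 (unzip2 (rcons c (a, t))) i = nth 0 (unzip2 c) i.
  by move=> ic; rewrite /unzip2 map_rcons nth_rcons size_map ic.
have t_last : nth 0 (unzip2 (rcons c (a, t))) (size c) = t.
  by rewrite /unzip2 map_rcons nth_rcons size_map ltnn eqxx.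
have p_last : nth y (unzip1 (rcons c (a, t))) (size c).+1 = y.
  by rewrite nth_default // size_map size_rcons.
have p_end : nth a (unzip1 c) (size c) = a by rewrite nth_default // size_map.
rewrite /weak_chain /= size_rcons big_ord_recr /= p_lt // t_last p_last p_lt //.
rewrite p_end ltrBrDr.
under eq_bigr => i _.
  rewrite (t_lt _ (ltn_ord i)) (p_lt _ (ltnW (ltn_ord i))) (p_lt _ (ltn_ord i)).
  over.
split=> [[Tt <- ?]|[Tt [Tts <- ?]]].
  split; first by rewrite -t_last; exact: Tt.
  by split=> // i ic; rewrite -t_lt //; apply/Tt/ltnW.
split=> // i; rewrite ltnS leq_eqVlt => /predU1P[->|ic]; first by rewrite t_last.
by rewrite t_lt //; exact: Tts.
Qed.

Lemma strong_chain_rcons e T x y c a t :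
  strong_chain psi e T x y (rcons c (a, t)) <->
  T <= t /\ weak_chain (e - mdist (psi t a) y) T x a c.
Proof. by rewrite strong_chainE weak_chain_rcons size_rcons; split=> [[]|]. Qed.

Lemma strong_chain1 e T t x : 0 < e -> T <= t ->
  exists c, strong_chain psi e T x (psi t x) c.
Proof.
move=> e0 Tt; exists (rcons [::] (x, t)); apply/strong_chain_rcons; split=> //.
by apply/weak_chain_nil; rewrite mdistxx subr0.
Qed.

Lemma strong_chain_step e T t x y c : T <= t -> strong_chain psi e T x y c ->
  exists c', strong_chain psi e T x (psi t y) c'.
Proof.
move=> Tt /strong_chainE[_ xyc]; exists (rcons c (y, t)).
by apply/strong_chain_rcons; split; rewrite // mdistxx subr0.
Qed.

Lemma strong_chain_gt0 e T x y c : strong_chain psi e T x y c -> 0 < e.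
Proof.
by case=> _ _ _; apply: le_lt_trans; apply: sumr_ge0 => i _; exact: mdist_ge0.
Qed.

Lemma weak_chain_le e e' T x y c : e <= e' ->
  weak_chain e T x y c -> weak_chain e' T x y c.
Proof. by move=> ee' [? ? /lt_le_trans ce]; split=> //; exact: ce. Qed.

Lemma strong_chain_le e e' T T' x y c : e <= e' -> T' <= T ->
  strong_chain psi e T x y c -> strong_chain psi e' T' x y c.
Proof.
move=> ee' TT' [c0 Tt px /lt_le_trans ce]; split=> //; last exact: ce.
by move=> i /Tt; exact: le_trans.
Qed.

(** * Chains and Lyapunov functions under the flow *)

Hypothesis psi_flow : continuous_flow psi.

Let psi0 x : psi 0 x = x. Proof. by case: psi_flow. Qed.
Let psiD t s x : psi (t + s) x = psi t (psi s x). Proof. by case: psi_flow. Qed.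

(** Only the last step changes: its time grows by [t]. The cost of the earlier steps is nonnegative,
    so [1 <= K] lets the factor [K] cover it too. The term [r] allows for a displaced endpoint. *)
Lemma strong_chain_prolong e T x y z t K r c : 0 <= t -> 1 <= K -> 0 <= r ->
  (forall a, mdist (psi t a) z <= K * mdist a y + r) ->
  strong_chain psi e T x y c ->
  exists c', strong_chain psi (K * e + r) T x z c'.
Proof.
move=> t0 K1 r0 psiK; case/lastP: c => [[]//|c [a u]].
move=> /strong_chain_rcons[Tu xac]; exists (rcons c (a, t + u)).
apply/strong_chain_rcons; split; first by rewrite (le_trans Tu) // lerDr.
have e_ge : 0 <= e - mdist (psi u a) y.
  have [_ _] := xac; move/ltW; apply: le_trans; apply: sumr_ge0 => i _.
  exact: mdist_ge0.
apply: weak_chain_le xac; rewrite psiD.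
have := psiK (psi u a); have := ler_wpM2r e_ge K1; lra.
Qed.

(** Having [psi T x] rather than [x] on the right makes a closed chain yield the reverse of the
    Lyapunov inequality. It comes from the first step, which lasts at least [T]. *)
Lemma lyapunov_strong_chain h C e T x y c : 0 <= T -> 0 <= C ->
  (forall a b, `|h a - h b| <= C * mdist a b) -> lyapunov_function psi h ->
  strong_chain psi e T x y c -> h y <= h (psi T x) + C * e.
Proof.
move=> T0 C0 hC hL; elim/last_ind: c e y => [|c [a t] IH] e y; first by case.
move=> /strong_chain_rcons[Tt xac].
have := hC y (psi t a); rewrite ler_norml metric_sym => /andP[_ hya].
have hta : h (psi t a) <= h (psi T x) + C * (e - mdist (psi t a) y).
  case: c IH xac => [_ /weak_chain_nil[-> e0]|b c IH xac].
    have := hL (t - T) _ (psi T x); rewrite -psiD subrK subr_ge0 => /(_ Tt).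
    by have := mulr_ge0 C0 (ltW e0); lra.
  have : h a <= h (psi T x) + C * (e - mdist (psi t a) y).
    by apply: IH; apply/strong_chainE.
  by apply: le_trans; apply: hL; exact: le_trans Tt.
by move: hta; rewrite mulrBr; lra.
Qed.

Lemma lipschitz_fun_ge0 h : lipschitz_fun h ->
  exists2 C, 0 <= C & forall x y, `|h x - h y| <= C * mdist x y.
Proof.
move=> [C hC]; exists `|C| => // x y; apply: le_trans (hC x y) _.
by rewrite ler_wpM2r ?mdist_ge0 ?ler_norm.
Qed.

Hypothesis psi_lip : lipschitz_on_compact_times psi.

Lemma lipschitz_times_ge1 T : 0 <= T -> exists2 K, 1 <= K &
  forall x y t, 0 <= t <= T -> mdist (psi t x) (psi t y) <= K * mdist x y.
Proof.
move=> /psi_lip[C psiC]; exists (Num.max 1 C); first by rewrite le_max lexx.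
move=> x y t /(psiC x y); move/le_trans; apply.
by rewrite ler_wpM2r ?mdist_ge0 // le_max lexx orbT.
Qed.

(** The members are strict upper bounds of chain costs, which have the same infimum as the costs. *)
Definition delayed_costs T x y : set R :=
  [set e | exists s c, 0 <= s <= T /\ strong_chain psi e T x (psi s y) c].

Definition delayed_cost T x y : R := inf (delayed_costs T x y).

Section DelayedCost.
Variables (T : R) (x : X).
Hypothesis T0 : 0 <= T.

Lemma delayed_costs_gt0 y e : delayed_costs T x y e -> 0 < e.
Proof. by move=> [s [c [_ /strong_chain_gt0]]]. Qed.

Lemma has_lbound_delayed_costs y : has_lbound (delayed_costs T x y).
Proof. by exists 0 => e /delayed_costs_gt0/ltW. Qed.

Lemma delayed_costs_lipschitz K y z e :
  1 <= K ->
  (forall x y t, 0 <= t <= T -> mdist (psi t x) (psi t y) <= K * mdist x y) ->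
  delayed_costs T x y e -> delayed_costs T x z (e + K * mdist y z).
Proof.
move=> K1 psiK [s [c [sT xyc]]].
have r0 : 0 <= K * mdist y z by rewrite mulr_ge0 ?mdist_ge0 // (le_trans ler01).
have [|c' xzc'] := strong_chain_prolong (z := psi s z) (lexx 0) (lexx 1) r0 _ xyc.
  move=> a; rewrite psi0 mul1r (le_trans (metric_triangle _ (psi s y) _)) //.
  by rewrite lerD2l psiK.
by exists s, c'; split=> //; rewrite mul1r in xzc'.
Qed.

(** Jumps may be arbitrarily large: a one-step chain ending at [psi T x] can be redirected to [y] at
    finite cost. *)
Lemma delayed_costs_nonempty y : delayed_costs T x y !=set0.
Proof.
have [K K1 psiK] := lipschitz_times_ge1 T0.
have [c xc] := strong_chain1 x (@ltr01 R) (lexx T).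
exists (1 + K * mdist (psi T x) y); apply: delayed_costs_lipschitz => //.
by exists 0, c; rewrite psi0 lexx.
Qed.

Lemma delayed_cost_ge0 y : 0 <= delayed_cost T x y.
Proof.
apply: lb_le_inf; first exact: delayed_costs_nonempty.
by move=> e /delayed_costs_gt0/ltW.
Qed.

Lemma lipschitz_delayed_cost : lipschitz_fun (delayed_cost T x).
Proof.
have [K K1 psiK] := lipschitz_times_ge1 T0.
have half y z : delayed_cost T x z - K * mdist y z <= delayed_cost T x y.
  apply: lb_le_inf; first exact: delayed_costs_nonempty.
  move=> e ye; rewrite lerBlDr; apply: ge_inf.
    exact: has_lbound_delayed_costs.
  exact: delayed_costs_lipschitz.
exists K => y z; have := half y z; have := half z y.
by rewrite (metric_sym z y) ler_norml => *; apply/andP; split; lra.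
Qed.

Lemma lyapunov_delayed_cost : lyapunov_function psi (delayed_cost T x).
Proof.
move=> t t0 y; apply: lb_le_inf; first exact: delayed_costs_nonempty.
move=> e [s [c [/andP[s0 sT] xyc]]].
apply: ge_inf; first exact: has_lbound_delayed_costs.
have [ts|st] := leP t s.
  by exists (s - t), c; rewrite -psiD subrK; split=> //; apply/andP; split; lra.
(* A further step of time [u] from [psi s y] leaves the delay [u + s - t] at [psi t y]: [T <= u]
   makes the step admissible, [t - s <= u] makes the delay nonnegative, and [s < t] keeps it at most
   [T]. *)
pose u := Num.max T (t - s).
have Tu : T <= u by rewrite le_max lexx.
have [c' xc'] := strong_chain_step Tu xyc.
exists (u + s - t), c'; rewrite -psiD subrK psiD; split=> //.
by rewrite /u; case: (leP T (t - s)) => ?; apply/andP; split; lra.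
Qed.

Lemma delayed_cost_image : delayed_cost T x (psi T x) = 0.
Proof.
apply/eqP; rewrite eq_le delayed_cost_ge0 andbT; apply/ler_addgt0Pr => e e0.
rewrite add0r; apply: ge_inf; first exact: has_lbound_delayed_costs.
have [c xc] := strong_chain1 x e0 (lexx T).
by exists 0, c; rewrite psi0 lexx.
Qed.

Lemma strong_chain_of_delayed_cost y e : delayed_cost T x (psi (- T) y) = 0 ->
  0 < e -> exists c, strong_chain psi e T x y c.
Proof.
move=> g0 e0; have [K K1 psiK] := lipschitz_times_ge1 T0.
have K0 : 0 < K by exact: lt_le_trans K1.
(* The bound [e / K] anticipates the factor [K] lost in the prolongation by [T - s]. *)
have [|e' [s [c [/andP[s0 sT] xc]]] e'e] :=
    inf_lt (delayed_costs_nonempty (psi (- T) y)) (x := e / K).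
  by rewrite -/(delayed_cost _ _ _) g0 divr_gt0.
have sT0 : 0 <= T - s by rewrite subr_ge0.
have [|c' xc'] := strong_chain_prolong (z := y) sT0 K1 (lexx 0) _ xc.
  move=> a; rewrite addr0 -[in leLHS](psi0 y).
  have -> : psi 0 y = psi (T - s) (psi s (psi (- T) y)).
    by rewrite -!psiD; congr (psi _ y); ring.
  by apply: psiK; rewrite sT0 lerBlDr lerDl.
exists c'; apply: strong_chain_le xc' => //.
by rewrite addr0 mulrC -ler_pdivlMr // ltW.
Qed.

End DelayedCost.

End StrongChainTheory.

Theorem theorem1 (R : realType) (X : metricType R) (psi : R -> X -> X)
    (psi_flow : continuous_flow psi)
    (psi_lip : lipschitz_on_compact_times psi) :
  (strongly_chain_recurrent psi <->
     (forall h : X -> R, lipschitz_fun h -> lyapunov_function psi h ->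
        first_integral psi h)) /\
  (strongly_chain_transitive psi <->
     (forall h : X -> R, lipschitz_fun h -> lyapunov_function psi h ->
        forall x y : X, h x = h y)).
Proof.
have [_ psi0 psiD] := psi_flow.
have limit0 (a b C : R) : 0 <= C -> (forall e, 0 < e -> a <= b + C * e) -> a <= b.
  move=> C0 abC; apply/ler_addgt0Pr => e e0.
  have C1 : 0 < C + 1 by lra.
  (* Dividing by [C + 1] also covers [C = 0]. *)
  have /abC/le_trans : 0 < e / (C + 1) by rewrite divr_gt0.
  apply; rewrite lerD2l mulrA ler_pdivrMr // mulrC ler_wpM2l ?ltW //; lra.
split; split.
- move=> rec h /lipschitz_fun_ge0[C C0 hC] hL.
  have fwd t x : 0 <= t -> h (psi t x) = h x.
    move=> t0; apply/eqP; rewrite eq_le hL //=.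
    apply: (limit0 _ _ C) => // e e0; have [c xc] := rec x e t e0 t0.
    exact: lyapunov_strong_chain xc.
  move=> t x; have [/fwd//|/ltW t0] := leP 0 t.
  by rewrite -(fwd (- t)) ?oppr_ge0 // -psiD addNr psi0.
- move=> first x e T e0 T0; apply: strong_chain_of_delayed_cost => //.
  (* Being constant on the orbit of [x], the delayed cost has at [psi (- T) x] its value at
     [psi T x], which is zero. *)
  have inv := first _ (lipschitz_delayed_cost psi_flow psi_lip x T0)
    (lyapunov_delayed_cost psi_flow psi_lip x T0).
  by rewrite inv -(inv T) delayed_cost_image.
- move=> trans h /lipschitz_fun_ge0[C C0 hC] hL.
  have le_h x y : h y <= h x.
    apply: (limit0 _ _ C) => // e e0; have [c xc] := trans x y e 0 e0 (lexx 0).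
    by rewrite -(psi0 x); exact: lyapunov_strong_chain xc.
  by move=> x y; apply/eqP; rewrite eq_le !le_h.
- move=> const x y e T e0 T0; apply: strong_chain_of_delayed_cost => //.
  rewrite (const _ (lipschitz_delayed_cost psi_flow psi_lip x T0)
    (lyapunov_delayed_cost psi_flow psi_lip x T0) _ (psi T x)).
  exact: delayed_cost_image.
Qed.
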